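(* For $n\ge 0$ let $L_n$ be the loop of signed basis elements of the standard real Cayley-Dickson algebra $A_n$ of dimension $2^n$. Then: (i) $N(L_1)=Z(L_1)=L_1$; (ii) $N(L_2)=L_2$ and $Z(L_2)=\{\pm 1\}$; (iii) $N(L_n)=Z(L_n)=\{\pm 1\}$ for every $n\ge 0$ with $n\notin\{1,2\}$.
   Context: The nucleus $N(L)$ of a loop $L$ is the set of all $a\in L$ with $a(xy)=(ax)y$, $x(ay)=(xa)y$ and $x(ya)=(xy)a$ for all $x,y\in L$; the center $Z(L)$ is the set of all $a\in N(L)$ with $ax=xa$ for all $x\in L$. An algebra over a field $F$ is an $F$-vector space with a bilinear (not necessarily associative) multiplication with neutral element $1$. Given a finite-dimensional algebra $D$ over $F$ with a quadratic form $N_D:D\to F$, let $\langle x,y\rangle_D=N_D(x+y)-N_D(x)-N_D(y)$ and $\overline{x}=\langle x,1\rangle_D 1-x$. The pair $(C,N_C)$ is obtained from $(D,N_D)$ by standard doubling if $C=D\oplus D$ as a vector space, with multiplication $(x,y)(u,v)=(xu-\overline{v}y,\ vx+y\overline{u})$ and $N_C((x,y))=N_D(x)+N_D(y)$. Let $A_0=\mathbb{R}$ with $N(x)=x^2$, and let $A_{n+1}$ be obtained from $A_n$ by standard doubling; thus $\dim A_n=2^n$. The basis $\{a_1,\dots,a_{2^n}\}$ of $A_n$ is chosen recursively: for $n=0$, $a_1=1$; if $d_1,\dots,d_m$ ($m=2^n$) is the chosen basis of $A_n$, then the chosen basis $c_1,\dots,c_{2m}$ of $A_{n+1}$ is $c_i=(d_i,0)$,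 $c_{i+m}=(0,d_i)$ for $1\le i\le m$. The set $L_n=\{\pm a_1,\dots,\pm a_{2^n}\}$ is a loop under the multiplication of $A_n$. *)

(* Defs.v *)
From HB Require Import structures.
From mathcomp Require Import all_boot all_order all_algebra.
From mathcomp Require Import all_classical reals.

Set Implicit Arguments.
Unset Strict Implicit.
Unset Printing Implicit Defensive.

Import Order.TTheory GRing.Theory Num.Theory.

Local Open Scope classical_set_scope.
Local Open Scope ring_scope.

(* Loops are carried by a subset of an ambient type, because L_n sits inside
   A_n; the operation only matters on the carrier. *)
Record loop (T : Type) := Loop {
  loop_set :> set T;
  loop_op : T -> T -> T;
  loop_e : T;
  loop_closed : forall x y, loop_set x -> loop_set y -> loop_set (loop_op x y);
  loop_e_in : loop_set loop_e;
  loop_el : forall x, loop_set x -> loop_op loop_e x = x;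
  loop_er : forall x, loop_set x -> loop_op x loop_e = x;
  loop_ldiv : forall a b, loop_set a -> loop_set b ->
    exists! x, loop_set x /\ loop_op a x = b;
  loop_rdiv : forall a b, loop_set a -> loop_set b ->
    exists! x, loop_set x /\ loop_op x a = b }.

Definition nucleus T (L : loop T) : set T :=
  let m := loop_op L in
  [set a | loop_set L a /\ forall x y, loop_set L x -> loop_set L y ->
     [/\ m a (m x y) = m (m a x) y,
         m x (m a y) = m (m x a) y &
         m x (m y a) = m (m x y) a]].

Definition center T (L : loop T) : set T :=
  [set a | nucleus L a /\
     forall x, loop_set L x -> loop_op L a x = loop_op L x a].

Definition polar (F : fieldType) (V : lmodType F) (N : V -> F) (x y : V) : F :=
  N (x + y) - N x - N y.

(* Unital, not necessarily associative algebras with a quadratic form. The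
   condition N(1) = 1 holds for the base algebra, is preserved by doubling, and
   is what makes (1, 0) a right neutral element of the double. *)
Record qalgebra (F : fieldType) := QAlgebra {
  qsort :> vectType F;
  qmul : qsort -> qsort -> qsort;
  qone : qsort;
  qform : qsort -> F;
  qmul_linear_r : forall x, linear (qmul x);
  qmul_linear_l : forall y, linear (fun x => qmul x y);
  qmul1x : forall x, qmul qone x = x;
  qmulx1 : forall x, qmul x qone = x;
  qformZ : forall a x, qform (a *: x) = a ^+ 2 * qform x;
  qform_polar : forall y, scalar (fun x => polar qform x y);
  qform1 : qform qone = 1 }.

Definition qconj (F : fieldType) (D : qalgebra F) (x : D) : D :=
  polar (@qform F D) x (qone D) *: qone D - x.

Section Doubling.
Variables (F : fieldType) (D : qalgebra F).
Implicit Types (p q : (D * D)%type) (x y u v : D).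

Definition dmul p q : (D * D)%type :=
  let: (x, y) := p in
  let: (u, v) := q in
  (qmul x u - qmul (qconj v) y, qmul v x + qmul y (qconj u)).

Definition dunit : (D * D)%type := (qone D, 0).

Definition dform p : F := qform p.1 + qform p.2.

Lemma qmulDr x y u : qmul x (y + u) = qmul x y + qmul x u.
Proof. by have := qmul_linear_r x 1 y u; rewrite !scale1r. Qed.

Lemma qmulDl x y u : qmul (x + y) u = qmul x u + qmul y u.
Proof. by have := qmul_linear_l u 1 x y; rewrite !scale1r. Qed.

Lemma qmulx0 x : qmul x 0 = 0.
Proof. by apply: (addrI (qmul x 0)); rewrite -qmulDr !addr0. Qed.

Lemma qmul0x x : qmul 0 x = 0.
Proof. by apply: (addrI (qmul 0 x)); rewrite -qmulDl !addr0. Qed.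

Lemma qmulxN x y : qmul x (- y) = - qmul x y.
Proof. by apply: (addrI (qmul x y)); rewrite -qmulDr !subrr qmulx0. Qed.

Lemma qmulNx x y : qmul (- x) y = - qmul x y.
Proof. by apply: (addrI (qmul x y)); rewrite -qmulDl !subrr qmul0x. Qed.

Lemma qmulZr a x y : qmul x (a *: y) = a *: qmul x y.
Proof. by have := qmul_linear_r x a y 0; rewrite qmulx0 !addr0. Qed.

Lemma qmulZl a x y : qmul (a *: x) y = a *: qmul x y.
Proof. by have := qmul_linear_l y a x 0; rewrite qmul0x !addr0. Qed.

Lemma qform0 : qform (0 : D) = 0.
Proof. by rewrite -(scale0r (0 : D)) qformZ expr2 !mul0r. Qed.

Lemma qconj_linear : linear (@qconj F D).
Proof.
move=> a x y; rewrite /qconj qform_polar scalerDl -scalerA scalerBr opprD.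
by rewrite addrACA.
Qed.

Lemma qconj1 : qconj (qone D) = qone D.
Proof.
rewrite /qconj; have -> : polar (@qform F D) (qone D) (qone D) = 2.
  rewrite /polar -mulr2n -scaler_nat qformZ qform1 mulr1 -natrX.
  by rewrite -addrA -opprD -[1 + 1]/(2%:R) -natrB.
by rewrite scaler_nat mulr2n addrK.
Qed.

Lemma qconj0 : qconj (0 : D) = 0.
Proof. by rewrite /qconj /polar add0r qform0 !subr0 subrr scale0r. Qed.

Definition qsimp0 :=
  (qmul0x, qmulx0, qconj0, @oppr0 D, @subr0 D, @sub0r D, @addr0 D, @add0r D).

Lemma qconjD x y : qconj (x + y) = qconj x + qconj y.
Proof. by have := qconj_linear 1 x y; rewrite !scale1r. Qed.

Lemma qconjZ a x : qconj (a *: x) = a *: qconj x.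
Proof. by have := qconj_linear a x 0; rewrite qconj0 !addr0. Qed.

Lemma qconjN x : qconj (- x) = - qconj x.
Proof. by rewrite -scaleN1r qconjZ scaleN1r. Qed.

Lemma qconjK : involutive (@qconj F D).
Proof.
move=> x; rewrite {2}/qconj qconjD qconjZ qconj1 qconjN /qconj.
by rewrite opprB addrC subrK.
Qed.

Fact dmul_linear_r p : linear (dmul p).
Proof.
case: p => x y a [u v] [u' v'].
rewrite /dmul /=; congr pair; rewrite /= qconj_linear.
  by rewrite qmul_linear_r qmul_linear_l scalerBr opprD addrACA.
by rewrite qmul_linear_r qmul_linear_l scalerDr addrACA.
Qed.

Fact dmul_linear_l q : linear (fun p => dmul p q).
Proof.
case: q => u v a [x y] [x' y']; rewrite /dmul /=; congr pair => /=.
  by rewrite qmul_linear_l qmul_linear_r scalerBr opprD addrACA.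
by rewrite qmul_linear_l qmul_linear_r scalerDr addrACA.
Qed.

Fact dmul1x p : dmul dunit p = p.
Proof.
by case: p => u v; rewrite /dmul /= qmul1x qmulx1 qmulx0 qmul0x subr0 addr0.
Qed.

Fact dmulx1 p : dmul p dunit = p.
Proof.
case: p => x y; rewrite /dmul /= qconj1 qconj0 !qmulx1 !qmul0x.
by rewrite subr0 add0r.
Qed.

Fact dformZ a p : dform (a *: p) = a ^+ 2 * dform p.
Proof. by rewrite /dform /= !qformZ mulrDr. Qed.

Lemma dpolarE p q :
  polar dform p q = polar (@qform F D) p.1 q.1 + polar (@qform F D) p.2 q.2.
Proof. rewrite /polar /dform /= !opprD (addrACA (qform _)); exact: addrACA. Qed.

Fact dform_polar q : scalar (fun p => polar dform p q).
Proof.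
by move=> a p p'; rewrite !dpolarE /= !qform_polar [in RHS]mulrDr; exact: addrACA.
Qed.

Fact dform1 : dform dunit = 1.
Proof. by rewrite /dform /= qform1 qform0 addr0. Qed.

Definition double : qalgebra F :=
  @QAlgebra F (D * D)%type dmul dunit dform dmul_linear_r dmul_linear_l
    dmul1x dmulx1 dformZ dform_polar dform1.

End Doubling.

Section Base.
Variable F : fieldType.

Let bmul (x y : F^o) : F^o := (x * y : F).
Let bform (x : F^o) : F := (x : F) ^+ 2.

Fact bmul_linear_r x : linear (bmul x).
Proof. by move=> a y z; rewrite /bmul mulrDr /GRing.scale /= mulrCA. Qed.

Fact bmul_linear_l y : linear (fun x => bmul x y).
Proof. by move=> a x z; rewrite /bmul mulrDl /GRing.scale /= mulrA. Qed.

Fact bform_scale (a : F) (x : F^o) : bform (a *: x) = a ^+ 2 * bform x.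
Proof. exact: exprMn. Qed.

Fact bform_polar y : scalar (fun x => polar bform x y).
Proof.
have polarE (u v : F) : polar bform u v = u * v *+ 2.
  have : (u + v) ^+ 2 - u ^+ 2 - v ^+ 2 = u * v *+ 2.
    by apply/eqP; rewrite !subr_eq sqrrD -addrA addrC.
  exact.
by move=> a x z; rewrite !polarE mulrDl mulrnDl mulrnAr /GRing.scale /= mulrA.
Qed.

Definition base_qalgebra : qalgebra F :=
  @QAlgebra F F^o bmul (1 : F) bform bmul_linear_r bmul_linear_l
    (@mul1r F) (@mulr1 F) bform_scale bform_polar (expr1n F 2).

End Base.

Section CayleyDickson.
Variable R : realType.

Fixpoint cayley_dickson (n : nat) : qalgebra R :=
  if n is n'.+1 then double (cayley_dickson n') else base_qalgebra R.

Local Notation A := cayley_dickson.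

Fixpoint cd_basis (n : nat) : seq (A n) :=
  match n return seq (A n) with
  | 0 => [:: qone (A 0)]
  | n'.+1 => [seq ((d, 0) : A n'.+1) | d <- cd_basis n'] ++
             [seq ((0, d) : A n'.+1) | d <- cd_basis n']
  end.

Definition cd_signed_basis (n : nat) : set (A n) :=
  [set a | a \in cd_basis n] `|` [set - a | a in [set a | a \in cd_basis n]].

Arguments cd_signed_basis : clear implicits.

Lemma cd_dim n : \dim {:A n} = (2 ^ n)%N.
Proof.
rewrite dimvf; elim: n => [|n IHn]; first by [].
by rewrite expnS mul2n -addnn -IHn.
Qed.

Lemma size_cd_basis n : size (cd_basis n) = (2 ^ n)%N.
Proof.
by elim: n => //= n IHn; rewrite size_cat !size_map IHn addnn -mul2n expnS.
Qed.

Lemma cd_basisP n : basis_of fullv (cd_basis n).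
Proof.
rewrite basisEdim size_cd_basis cd_dim leqnn andbT; apply/subvP => x _.
elim: n x => [|n IHn] x.
  have -> : x = (x : R) *: qone (A 0) by rewrite /GRing.scale /= mulr1.
  by rewrite memvZ // memv_span // mem_head.
case: x => x y.
have span_lin (f : {linear A n -> A n.+1}) (z : A n) :
    (forall d, d \in cd_basis n -> f d \in cd_basis n.+1) ->
    f z \in <<cd_basis n.+1>>%VS.
  move=> fB; rewrite (coord_span (X := in_tuple (cd_basis n)) (IHn z)).
  rewrite linear_sum; apply: memv_suml => i _.
  by rewrite linearZ memvZ // memv_span // fB // mem_nth.
have lin1 : linear (fun d : A n => (d, 0) : A n.+1).
  by move=> a u v; congr pair; rewrite /= scaler0 addr0.
have lin2 : linear (fun d : A n => (0, d) : A n.+1).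
  by move=> a u v; congr pair; rewrite /= scaler0 addr0.
pose f1 := GRing.isLinear.Build _ _ _ _ _ lin1.
pose f2 := GRing.isLinear.Build _ _ _ _ _ lin2.
pose F1 : {linear A n -> A n.+1} := HB.pack (fun d : A n => (d, 0) : A n.+1) f1.
pose F2 : {linear A n -> A n.+1} := HB.pack (fun d : A n => (0, d) : A n.+1) f2.
have -> : ((x, y) : A n.+1) = F1 x + F2 y.
  by congr pair; rewrite /= ?addr0 ?add0r.
apply: memvD; apply: span_lin => d dB; rewrite /= mem_cat.
  by rewrite map_f.
by apply/orP; right; apply: map_f.
Qed.

Local Notation S := cd_signed_basis.

Lemma cd_signed_basis0 a : S 0 a <-> a = qone (A 0) \/ a = - qone (A 0).
Proof.
split=> [[|[b + <-]]|[->|->]]; rewrite /= ?inE.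
- by move/eqP=> ->; left.
- by move/eqP=> ->; right.
- by left; rewrite /= inE.
- by right; exists (qone (A 0)); rewrite //= inE.
Qed.

Lemma cd_signed_basisS n (p : A n.+1) :
  S n.+1 p <-> (S n p.1 /\ p.2 = 0) \/ (p.1 = 0 /\ S n p.2).
Proof.
split.
  case=> [|[b + <-]]; rewrite /= mem_cat => /orP[] /mapP[d dB ->] /=.
  - by left; split=> //; left.
  - by right; split=> //; left.
  - by left; split; [right; exists d|rewrite oppr0].
  - by right; split; [rewrite oppr0|right; exists d].
case: p => x y [[/= Sx ->]|[/= -> Sy]].
  case: Sx => [xB|[d dB <-]].
    by left; rewrite /= mem_cat map_f.
  right; exists ((d, 0) : A n.+1); first by rewrite /= mem_cat map_f.
  by congr pair; rewrite /= oppr0.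
case: Sy => [yB|[d dB <-]].
  by left; rewrite /= mem_cat; apply/orP; right; apply: map_f.
right; exists ((0, d) : A n.+1); last by congr pair; rewrite /= oppr0.
by rewrite /= mem_cat; apply/orP; right; apply: map_f.
Qed.

Lemma cd_signed_basis_neq0 n : ~ S n 0.
Proof.
elim: n => [|n IHn].
  move/cd_signed_basis0 => []/eqP; first by rewrite eq_sym oner_eq0.
  by rewrite eq_sym oppr_eq0 oner_eq0.
by case/cd_signed_basisS => -[].
Qed.

Lemma cd_signed_basisN n a : S n a -> S n (- a).
Proof.
case=> [aB|[b bB <-]]; first by right; exists a.
by rewrite opprK; left.
Qed.

Lemma cd_signed_basis1 n : S n (qone (A n)).
Proof.
elim: n => [|n IHn]; first by apply/cd_signed_basis0; left.
by apply/cd_signed_basisS; left.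
Qed.

Lemma qconj_double (D : qalgebra R) (p : double D) :
  qconj p = (qconj p.1, - p.2).
Proof.
case: p => x y; rewrite /qconj dpolarE /= {2}/polar addr0 subrr sub0r qform0.
rewrite oppr0 addr0; congr pair.
by rewrite /= scaler0 add0r.
Qed.

Lemma cd_signed_basis_conj n a : S n a -> S n (qconj a).
Proof.
elim: n a => [|n IHn] a.
  by case/cd_signed_basis0 => ->; rewrite ?qconjN qconj1;
    [|apply: cd_signed_basisN]; apply: cd_signed_basis1.
case/cd_signed_basisS => -[p1 p2]; apply/cd_signed_basisS;
  rewrite qconj_double /=.
  by left; rewrite p2 oppr0; split=> //; apply: IHn.
by right; rewrite p1 qconj0; split=> //; apply: cd_signed_basisN.
Qed.

Lemma cd_signed_basisM n a b : S n a -> S n b -> S n (qmul a b).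
Proof.
elim: n a b => [|n IHn] a b.
  case/cd_signed_basis0 => ->; case/cd_signed_basis0 => ->;
    rewrite ?qmulNx ?qmulxN qmul1x ?opprK; do ?apply: cd_signed_basisN;
    exact: cd_signed_basis1.
case: a b => x y [u v] /cd_signed_basisS /= [[Sx ->]|[-> Sy]];
  case/cd_signed_basisS => /= [[Su ->]|[-> Sv]]; apply/cd_signed_basisS => /=.
- left; rewrite !qsimp0; split=> //; exact: IHn.
- right; rewrite !qsimp0; split=> //; exact: IHn.
- right; rewrite !qsimp0; split=> //.
  by apply: IHn => //; apply: cd_signed_basis_conj.
- left; rewrite !qsimp0; split=> //.
  by apply: cd_signed_basisN; apply: IHn => //; apply: cd_signed_basis_conj.
Qed.

Lemma cd_signed_basis_div n a b : S n a -> S n b ->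
  (exists! x, S n x /\ qmul a x = b) /\ (exists! x, S n x /\ qmul x a = b).
Proof.
elim: n a b => [|n IHn] a b.
  have mulC (x y : A 0) : qmul x y = qmul y x by exact: mulrC.
  have sq1 (x : A 0) : S 0 x -> qmul x x = qone (A 0).
    by case/cd_signed_basis0 => ->; rewrite ?qmulNx ?qmulxN qmul1x ?opprK.
  have mulA (x y z : A 0) : qmul x (qmul y z) = qmul (qmul x y) z.
    exact: mulrA.
  move=> Sa Sb; have H : exists! x, S 0 x /\ qmul a x = b.
    exists (qmul a b); split=> [|x [Sx <-]]; last by rewrite mulA sq1 // qmul1x.
    by split; [exact: cd_signed_basisM|rewrite mulA sq1 // qmul1x].
  split=> //; case: H => x [[Sx xE] xU]; exists x.
  by split=> [|y [Sy yE]]; [rewrite mulC|apply: xU; rewrite mulC].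
have S0 := @cd_signed_basis_neq0 n.
have Sc := @cd_signed_basis_conj n.
have SN := @cd_signed_basisN n.
case: a b => x y [s t] /cd_signed_basisS /= [[Sx ->]|[-> Sy]];
  case/cd_signed_basisS => /= [[Ss ->]|[-> St]]; split.
- have [[u [[Su uE] uU]] _] := IHn x s Sx Ss.
  exists (u, 0); split.
    split; first by apply/cd_signed_basisS; left.
    by rewrite /= !qsimp0 uE.
  move=> [u' v'] [/cd_signed_basisS /= [[Su' ->]|[-> Sv']]].
    by rewrite /= !qsimp0 => -[/(conj Su') /uU ->].
  rewrite /= !qsimp0 => -[sE]; by case: S0; rewrite sE.
- have [_ [u [[Su uE] uU]]] := IHn x s Sx Ss.
  exists (u, 0); split.
    split; first by apply/cd_signed_basisS; left.
    by rewrite /= !qsimp0 uE.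
  move=> [u' v'] [/cd_signed_basisS /= [[Su' ->]|[-> Sv']]].
    by rewrite /= !qsimp0 => -[/(conj Su') /uU ->].
  rewrite /= !qsimp0 => -[sE]; by case: S0; rewrite sE.
- have [_ [v [[Sv vE] vU]]] := IHn x t Sx St.
  exists (0, v); split.
    split; first by apply/cd_signed_basisS; right.
    by rewrite /= !qsimp0 vE.
  move=> [u' v'] [/cd_signed_basisS /= [[Su' ->]|[-> Sv']]].
    rewrite /= !qsimp0 => -[_ tE]; by case: S0; rewrite tE.
  by rewrite /= !qsimp0 => -[/(conj Sv') /vU ->].
- have [_ [v [[Sv vE] vU]]] := IHn (qconj x) t (Sc _ Sx) St.
  exists (0, v); split.
    split; first by apply/cd_signed_basisS; right.
    by rewrite /= !qsimp0 vE.
  move=> [u' v'] [/cd_signed_basisS /= [[Su' ->]|[-> Sv']]].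
    rewrite /= !qsimp0 => -[_ tE]; by case: S0; rewrite tE.
  by rewrite /= !qsimp0 => -[/(conj Sv') /vU ->].
- have [_ [v [[Sv vE] vU]]] := IHn y (- s) Sy (SN _ Ss).
  exists (0, qconj v); split.
    split; first by apply/cd_signed_basisS; right; split=> //; apply: Sc.
    by rewrite /= !qsimp0 qconjK vE opprK.
  move=> [u' v'] [/cd_signed_basisS /= [[Su' ->]|[-> Sv']]].
    rewrite /= !qsimp0 => -[sE]; by case: S0; rewrite sE.
  rewrite /= !qsimp0 => -[/(congr1 -%R)]; rewrite opprK => vE'.
  by rewrite (vU _ (conj (Sc _ Sv') vE')) qconjK.
- have [[v [[Sv vE] vU]] _] := IHn (qconj y) (- s) (Sc _ Sy) (SN _ Ss).
  exists (0, v); split.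
    split; first by apply/cd_signed_basisS; right.
    by rewrite /= !qsimp0 vE opprK.
  move=> [u' v'] [/cd_signed_basisS /= [[Su' ->]|[-> Sv']]].
    rewrite /= !qsimp0 => -[sE]; by case: S0; rewrite sE.
  rewrite /= !qsimp0 => -[/(congr1 -%R)]; rewrite opprK => vE'.
  by rewrite (vU _ (conj Sv' vE')).
- have [[u [[Su uE] uU]] _] := IHn y t Sy St.
  exists (qconj u, 0); split.
    split; first by apply/cd_signed_basisS; left; split=> //; apply: Sc.
    by rewrite /= !qsimp0 qconjK uE.
  move=> [u' v'] [/cd_signed_basisS /= [[Su' ->]|[-> Sv']]].
    rewrite /= !qsimp0 => -[/(conj (Sc _ Su')) /uU ->].
    by rewrite qconjK.
  rewrite /= !qsimp0 => -[_ tE]; by case: S0; rewrite tE.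
- have [[u [[Su uE] uU]] _] := IHn y t Sy St.
  exists (u, 0); split.
    split; first by apply/cd_signed_basisS; left.
    by rewrite /= !qsimp0 uE.
  move=> [u' v'] [/cd_signed_basisS /= [[Su' ->]|[-> Sv']]].
    by rewrite /= !qsimp0 => -[/(conj Su') /uU ->].
  rewrite /= !qsimp0 => -[_ tE]; by case: S0; rewrite tE.
Qed.

Definition cd_loop (n : nat) : loop (A n) :=
  @Loop (A n) (S n) (@qmul R (A n)) (qone (A n))
    (@cd_signed_basisM n) (@cd_signed_basis1 n)
    (fun x _ => qmul1x x) (fun x _ => qmulx1 x)
    (fun a b Sa Sb => proj1 (cd_signed_basis_div Sa Sb))
    (fun a b Sa Sb => proj2 (cd_signed_basis_div Sa Sb)).

End CayleyDickson.

(* Main.v *)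
(** For [n >= 2] the only elements of [L_n] commuting with all of [L_n] are
    [1] and [-1]: testing [(x, 0)] against [(0, 1)] gives
    [qconj x = x], and testing [(0, y)] against [(u, 0)] with [qconj u = - u]
    gives [2 y u = 0].  In a double, the associativity of triples such as
    [(x, 0), (u, 0), (0, 1)] amounts to commutation of [x] with [u], so a
    nuclear element of [L_(n+1)] has a component commuting with [L_n]; the
    elements [(0, y)] are excluded because they would force all of [L_n] to be
    commutative.  For [n <= 2] the algebra itself is associative. *)

Require Import Defs.
From mathcomp Require Import all_boot all_order all_algebra.
From mathcomp Require Import all_classical reals.
From mathcomp Require Import ring.

Set Implicit Arguments.
Unset Strict Implicit.
Unset Printing Implicit Defensive.

Import Order.TTheory GRing.Theory Num.Theory.

Local Open Scope classical_set_scope.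
Local Open Scope ring_scope.

Section DoubleMul.
Variables (F : realType) (D : qalgebra F).
Implicit Types x y u v : D.

Lemma dmul_ll x u : qmul ((x, 0) : Defs.double D) (u, 0) = (qmul x u, 0).
Proof. by rewrite /= !qsimp0. Qed.

Lemma dmul_lr x v : qmul ((x, 0) : Defs.double D) (0, v) = (0, qmul v x).
Proof. by rewrite /= !qsimp0. Qed.

Lemma dmul_rl y u : qmul ((0, y) : Defs.double D) (u, 0) = (0, qmul y (qconj u)).
Proof. by rewrite /= !qsimp0. Qed.

Lemma dmul_rr y v : qmul ((0, y) : Defs.double D) (0, v) = (- qmul (qconj v) y, 0).
Proof. by rewrite /= !qsimp0. Qed.

Definition dmulE := (dmul_ll, dmul_lr, dmul_rl, dmul_rr).

(** Conjugation is assumed to be a homomorphism, so it can be pushed onto single variables; each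
    component of both bracketings then expands to the same four monomials. *)
Lemma qmul_double_assoc :
  associative (@qmul F D) -> commutative (@qmul F D) ->
  (forall a b : D, qconj (qmul a b) = qmul (qconj a) (qconj b)) ->
  associative (@qmul F (Defs.double D)).
Proof.
move=> mA mC cM [a b] [c d] [f g]; rewrite /=.
have mCA x y z : qmul x (qmul y z) = qmul y (qmul x z) :> D.
  by rewrite !mA (mC x).
rewrite !(qconjD, qconjN, cM, qconjK).
move: (qconj c) (qconj d) (qconj f) (qconj g) => c' d' f' g'.
congr pair; rewrite !(qmulDl, qmulDr, qmulNx, qmulxN).
  rewrite (mA a c f) (mCA a g' d) (mC d a) -(mA g' c' b) (mC c' b).
  rewrite -(mA d' f b) (mC f b) (mA d' b f).
  by rewrite opprD -!addrA; congr (_ + _); rewrite addrA addrC opprD.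
rewrite -(mA g c a) (mC c a) -(mA d f' a) (mC f' a) (mA d a f').
rewrite (mA b c' f') (mCA b g d') (mC b d').
by rewrite -!addrA; congr (_ + _); rewrite addrA addrC.
Qed.

Lemma qmul_double_comm : commutative (@qmul F D) -> (forall x : D, qconj x = x) ->
  commutative (@qmul F (Defs.double D)).
Proof.
move=> mC cI [x y] [u v]; rewrite /= !cI.
by rewrite (mC x) (mC v y) (addrC (qmul v x)).
Qed.

(** Supplies the third hypothesis of [qmul_double_assoc] for the step from complex numbers to
    quaternions. *)
Lemma qconj_double_mul : (forall x : D, qconj x = x) ->
  forall a b : Defs.double D, qconj (qmul a b) = qmul (qconj a) (qconj b).
Proof.
move=> cI [x y] [u v]; rewrite !qconj_double /= !cI.
by rewrite !(qmulNx, qmulxN, opprK) opprD.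
Qed.

End DoubleMul.

Section SignedBasis.
Variable R : realType.
Local Notation A := (cayley_dickson R).
Local Notation S := (@cd_signed_basis R _).
Local Notation e n := (qone (A n)).

Definition pm1 n : set (A n) := [set e n; - e n].

Lemma cd_signed_basis_split n (a : A n.+1) : S a ->
  (exists2 x : A n, S x & a = (x, 0)) \/ (exists2 y : A n, S y & a = (0, y)).
Proof.
by case/cd_signed_basisS; case: a => x y [/= h k]; [left; exists x|right; exists y];
  rewrite // ?h ?k.
Qed.

Lemma cd_inl_signed_basis n (x : A n) : S x -> S ((x, 0) : A n.+1).
Proof. by move=> Sx; apply/cd_signed_basisS; left. Qed.

Lemma cd_inr_signed_basis n (y : A n) : S y -> S ((0, y) : A n.+1).
Proof. by move=> Sy; apply/cd_signed_basisS; right. Qed.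

Lemma oppr_fixed_eq0 (V : lmodType R) (x : V) : x = - x -> x = 0.
Proof.
move=> /eqP; rewrite -subr_eq0 opprK -mulr2n -scaler_nat scaler_eq0.
by rewrite pnatr_eq0 => /eqP.
Qed.

(** Conjugation negates the second component, so a fixed [(0, x)] would have [x = 0]; a fixed
    [(x, 0)] reduces to [x] one level below. *)
Lemma cd_conj_fixed n (a : A n) : S a -> qconj a = a -> pm1 a.
Proof.
elim: n a => [|n IHn] a; first by move=> /cd_signed_basis0.
case/cd_signed_basis_split => -[x Sx ->]; rewrite qconj_double /=.
  case=> /(IHn _ Sx) [] -> _; [left|right] => //.
  by congr pair; rewrite /= oppr0.
by case=> _ /esym /oppr_fixed_eq0 x0; case: (@cd_signed_basis_neq0 R n); rewrite -x0.
Qed.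

Lemma pm1_signed_basis n (a : A n) : pm1 a -> S a.
Proof.
by case=> ->; [|apply: cd_signed_basisN]; apply: cd_signed_basis1.
Qed.

(** The imaginary unit adjoined by the last doubling, used below as a test element. *)
Definition cd_unit2 n : A n.+1 := (0, e n).

Lemma cd_unit2_signed_basis n : S (cd_unit2 n).
Proof. by apply: cd_inr_signed_basis; exact: cd_signed_basis1. Qed.

Lemma qconj_cd_unit2 n : qconj (cd_unit2 n) = - cd_unit2 n.
Proof. by rewrite qconj_double /= qconj0; congr pair; rewrite /= oppr0. Qed.

Lemma cd_unit2_notin_pm1 n : ~ pm1 (cd_unit2 n).
Proof.
have e0 : e n <> 0.
  by move=> e0; apply: (@cd_signed_basis_neq0 R n); rewrite -e0; exact: cd_signed_basis1.
by case=> [[_ /e0]|[_]] //; rewrite oppr0 => /e0.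
Qed.

Lemma cd_commutant n (a : A n.+2) : S a ->
  (forall x, S x -> qmul a x = qmul x a) -> pm1 a.
Proof.
move=> Sa; case: (cd_signed_basis_split Sa) => -[x Sx aE]; subst a => aC.
  have := aC _ (cd_unit2_signed_basis n.+1).
  rewrite /cd_unit2 !dmulE !qmul1x => /(congr1 snd) xE.
  have {}xE : x = qconj x := xE.
  apply: (cd_conj_fixed Sa).
  by rewrite qconj_double; congr pair; [exact: esym xE|exact: oppr0].
(* Here [a = (0, x)]. The index [n.+2] guarantees an imaginary [u] in [A n.+1]; commuting with
   [(u, 0)] gives [- x u = x u], although [x u] is a nonzero signed basis element. *)
have Su := cd_unit2_signed_basis n.
have := aC _ (cd_inl_signed_basis Su).
rewrite !dmulE qconj_cd_unit2 qmulxN => /(congr1 snd) xuE.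
have {}xuE : - qmul x (cd_unit2 n) = qmul x (cd_unit2 n) := xuE.
case: (@cd_signed_basis_neq0 R n.+1).
by rewrite -(oppr_fixed_eq0 (esym xuE)); apply: cd_signed_basisM.
Qed.

Lemma cd_nucleus_sub n : nucleus (cd_loop R n.+3) `<=` @pm1 n.+3.
Proof.
have inl := @cd_inl_signed_basis n.+2; have inr := @cd_inr_signed_basis n.+2.
have S1 := @cd_signed_basis1 R n.+2.
move=> a [Sa]; case: (cd_signed_basis_split Sa) => -[x Sx aE]; subst a => aN.
  have: pm1 x.
    apply: (cd_commutant Sx) => u Su.
    have [+ _ _] := aN _ _ (inl _ Su) (inr _ S1).
    rewrite /loop_op /cd_loop !dmulE !qmul1x => uxE.
    exact: esym (congr1 snd uxE).
  case=> ->; [by left|right].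
  by congr pair; exact: esym (oppr0 _).
(* Now [a = (0, x)]: associating [a], [(0, 1)], [(v, 0)] yields [- v x = - x v]. *)
have xC : pm1 x.
  apply: (cd_commutant Sx) => v Sv.
  have [+ _ _] := aN _ _ (inr _ S1) (inl _ Sv).
  rewrite /loop_op /cd_loop !dmulE qconj1 !qmul1x qconjK qmulNx => vxE.
  exact: esym (oppr_inj (congr1 fst vxE)).
(* It remains to exclude [x = 1] and [x = - 1]. With [u] the imaginary unit, associating [(u, 0)],
   [(v, 0)], [a] gives [(x v) u = x (u v)], so [u] would commute with every [v]. *)
case: (@cd_unit2_notin_pm1 n.+1); apply: cd_commutant.
  exact: cd_unit2_signed_basis.
move=> v Sv; have Su := cd_unit2_signed_basis n.+1.
have [_ _] := aN _ _ (inl _ Su) (inl _ Sv).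
rewrite /loop_op /cd_loop !dmulE => /(congr1 snd) uvE.
have : qmul (qmul x v) (cd_unit2 n.+1) = qmul x (qmul (cd_unit2 n.+1) v).
  exact: uvE.
by case: xC => ->; rewrite ?qmulNx !qmul1x; [|move/oppr_inj].
Qed.

Lemma pm1_center n : @pm1 n `<=` center (cd_loop R n).
Proof.
move=> a pa; split=> [|x _]; last first.
  by case: pa => -> /=; rewrite ?qmulNx ?qmulxN qmul1x qmulx1.
split=> [|x y _ _]; first exact: pm1_signed_basis.
by case: pa => -> /=; split; rewrite ?(qmulNx, qmulxN, qmul1x, qmulx1).
Qed.

Lemma qconj_cd0 (x : A 0) : qconj x = x.
Proof.
rewrite /qconj /polar /=; rewrite /GRing.scale /=.
(* The goal is restated in [R], where [ring] recognises the operations. *)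
by move: (x : R) => {}x; rewrite -[LHS]/(((x + 1) ^+ 2 - x ^+ 2 - 1 ^+ 2) * 1 - x); ring.
Qed.

Lemma qmul_cd1A : associative (@qmul R (A 1)).
Proof.
apply: qmul_double_assoc; [exact: (@mulrA R)|exact: (@mulrC R)|].
by move=> a b; rewrite !qconj_cd0.
Qed.

Lemma qmul_cd1C : commutative (@qmul R (A 1)).
Proof. by apply: qmul_double_comm; [exact: (@mulrC R)|exact: qconj_cd0]. Qed.

Lemma qconj_cd1M (a b : A 1) : qconj (qmul a b) = qmul (qconj a) (qconj b).
Proof. by apply: qconj_double_mul; exact: qconj_cd0. Qed.

Lemma qmul_cd2A : associative (@qmul R (A 2)).
Proof. exact: qmul_double_assoc qmul_cd1A qmul_cd1C qconj_cd1M. Qed.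

Lemma cd_nucleus_assoc n :
  associative (@qmul R (A n)) -> nucleus (cd_loop R n) = cd_loop R n.
Proof.
by move=> mA; apply/seteqP; split=> a; [case|split=> // x y _ _; split; exact: mA].
Qed.

Lemma cd_center_comm n : commutative (@qmul R (A n)) ->
  center (cd_loop R n) = nucleus (cd_loop R n).
Proof.
by move=> mC; apply/seteqP; split=> a; [case|split=> // x _; exact: mC].
Qed.

Lemma cd_center2 : center (cd_loop R 2) = @pm1 2.
Proof.
apply/seteqP; split=> [a [[Sa _] aC]|]; last exact: pm1_center.
exact: (@cd_commutant 0).
Qed.

Lemma cd_loop0 : cd_loop R 0 = @pm1 0 :> set _.
Proof. by apply/seteqP; split=> a /cd_signed_basis0. Qed.

End SignedBasis.

Theorem proposition7p2 (R : realType) :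
  let L := cd_loop R in
  let pm1 := fun n : nat =>
    [set qone (cayley_dickson R n); (- qone (cayley_dickson R n))%R]%classic in
  [/\ nucleus (L 1) = L 1 /\ center (L 1) = L 1,
      nucleus (L 2) = L 2 /\ center (L 2) = pm1 2
    & forall n : nat, n <> 1 -> n <> 2 ->
        nucleus (L n) = pm1 n /\ center (L n) = pm1 n].
Proof.
move=> L pm1'; rewrite /L /pm1'; split.
- rewrite (cd_center_comm (@qmul_cd1C R)).
  by rewrite (cd_nucleus_assoc (@qmul_cd1A R)).
- by split; [exact: cd_nucleus_assoc (@qmul_cd2A R)|exact: cd_center2].
(* For [n = 0] the loop itself is [pm1]; the noncommutativity argument starts at [n = 3]. *)
case=> [|[|[|n]]] // _ _.
  rewrite cd_center_comm; last exact: (@mulrC R).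
  rewrite cd_nucleus_assoc; last exact: (@mulrA R).
  by split; exact: cd_loop0.
have sub := @cd_nucleus_sub R n; have sup := @pm1_center R n.+3.
split; apply/seteqP; split => // a.
- by case/sup.
- by case=> /sub.
Qed.
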